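(* Let $n,m,k$ be positive integers with $k\le m$, let $I=\{1,\dots,m\}$, $J=\{1,\dots,k\}$, and let ${\mathbf a}^1,\dots,{\mathbf a}^m\in\mathbb R^n$. Consider the problems (MIP) and (NS) defined in the context. Then both (MIP) and (NS) have (global) solutions. If ${\mathbf a}^1,\dots,{\mathbf a}^m$ are pairwise distinct, then the sets of (global) solutions of (MIP) and of (NS) are finite. Moreover, in that case, if $\bar{\mathbf x}=(\bar{\mathbf x}^1,\dots,\bar{\mathbf x}^k)\in\mathbb R^{n\times k}$ is a global solution of (NS), then for every $j\in J$ the attraction set $A[\bar{\mathbf x}^j]$ is nonempty and $$\bar{\mathbf x}^j=\frac{1}{|I(j)|}\sum_{i\in I(j)}{\mathbf a}^i,$$ where $I(j)=\{i\in I\mid {\mathbf a}^i\in A[\bar{\mathbf x}^j]\}$ and $|\Omega|$ denotes the number of elements of a finite set $\Omega$.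
   Context: $\mathbb R^n$ carries the Euclidean norm $\|\cdot\|$; elements of $\mathbb R^{n\times k}$ are written $\mathbf x=({\mathbf x}^1,\dots,{\mathbf x}^k)$ with ${\mathbf x}^j\in\mathbb R^n$. The data set is $A=\{{\mathbf a}^1,\dots,{\mathbf a}^m\}\subset\mathbb R^n$ (an indexed system; repetitions are possible unless distinctness is assumed). (MIP): minimize $$\psi(\mathbf x,\alpha)=\frac1m\sum_{i=1}^m\Big(\sum_{j=1}^k\alpha_{ij}\|{\mathbf a}^i-{\mathbf x}^j\|^2\Big)$$ over all $\mathbf x\in\mathbb R^{n\times k}$ and all matrices $\alpha=(\alpha_{ij})\in\mathbb R^{m\times k}$ with $\alpha_{ij}\in\{0,1\}$ for all $i\in I$, $j\in J$ and $\sum_{j=1}^k\alpha_{ij}=1$ for all $i\in I$. (NS): minimize $$f(\mathbf x)=\frac1m\sum_{i=1}^m\Big(\min_{j\in J}\|{\mathbf a}^i-{\mathbf x}^j\|^2\Big)$$ over all $\mathbf x\in\mathbb R^{n\times k}$. For $\bar{\mathbf x}\in\mathbb R^{n\times k}$ and $j\in J$, the attraction set of the component $\bar{\mathbf x}^j$ is $A[\bar{\mathbf x}^j]=\{{\mathbf a}^i\in A\mid \|{\mathbf a}^i-\bar{\mathbf x}^j\|=\min_{q\in J}\|{\mathbf a}^i-\bar{\mathbf x}^q\|\}$. *)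

(* Defs.v *)
From HB Require Import structures.
From mathcomp Require Import all_boot all_order all_algebra.
From mathcomp Require Import boolp classical_sets cardinality reals.
Set Implicit Arguments.
Unset Strict Implicit.
Unset Printing Implicit Defensive.
Import Order.TTheory GRing.Theory Num.Theory.
Local Open Scope classical_set_scope.
Local Open Scope ring_scope.

(* Minimum-sum-of-squares clustering: a tuple
   x = (x^1, ..., x^k) of points of R^n is an n x k matrix whose j-th column
   [col j x] is x^j; the data a^1, ..., a^m form a family [a : 'I_m -> 'cV_n],
   which may have repetitions. *)

(* Not the norm [`|v|] that MathComp-Analysis puts on matrices, which is the
   sup norm. *)
Definition enorm (R : realType) (n : nat) (v : 'cV[R]_n) : R :=
  Num.sqrt (\sum_(i < n) v i 0 ^+ 2).

(* [hk] makes the index set nonempty; the starting value of the iteration is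
   itself one of the values of F, so that the result is the minimum of F. *)
Definition minJ (R : realType) (k : nat) (hk : (0 < k)%N) (F : 'I_k -> R) : R :=
  \big[Num.min/F (Ordinal hk)]_(j < k) F j.

Definition global_solutions (R : realType) (T : Type) (D : set T) (F : T -> R)
  : set T := [set x | D x /\ forall y, D y -> F x <= F y].

Definition MIP_feasible (R : realType) (n m k : nat)
  : set ('M[R]_(n, k) * 'M[R]_(m, k)) :=
  [set p : 'M[R]_(n, k) * 'M[R]_(m, k) |
     (forall i j, p.2 i j = 0 \/ p.2 i j = 1) /\
     (forall i, \sum_(j < k) p.2 i j = 1)].

Definition psi (R : realType) (n m k : nat) (a : 'I_m -> 'cV[R]_n)
    (p : 'M[R]_(n, k) * 'M[R]_(m, k)) : R :=
  m%:R^-1 *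
  \sum_(i < m) \sum_(j < k) p.2 i j * enorm (a i - col j p.1) ^+ 2.

Definition MIP_solutions (R : realType) (n m k : nat) (a : 'I_m -> 'cV[R]_n)
  : set ('M[R]_(n, k) * 'M[R]_(m, k)) :=
  global_solutions (@MIP_feasible R n m k) (psi a).

Definition NS_objective (R : realType) (n m k : nat) (hk : (0 < k)%N)
    (a : 'I_m -> 'cV[R]_n) (x : 'M[R]_(n, k)) : R :=
  m%:R^-1 * \sum_(i < m) minJ hk (fun j => enorm (a i - col j x) ^+ 2).

Definition NS_solutions (R : realType) (n m k : nat) (hk : (0 < k)%N)
    (a : 'I_m -> 'cV[R]_n) : set 'M[R]_(n, k) :=
  global_solutions [set: 'M[R]_(n, k)] (NS_objective hk a).

Definition attraction_set (R : realType) (n m k : nat) (hk : (0 < k)%N)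
    (a : 'I_m -> 'cV[R]_n) (x : 'M[R]_(n, k)) (j : 'I_k) : set 'cV[R]_n :=
  [set p | range a p /\
           enorm (p - col j x) = minJ hk (fun q => enorm (p - col q x))].

Definition attraction_indices (R : realType) (n m k : nat) (hk : (0 < k)%N)
    (a : 'I_m -> 'cV[R]_n) (x : 'M[R]_(n, k)) (j : 'I_k) : {set 'I_m} :=
  [set i : 'I_m | a i \in attraction_set hk a x j]%SET.

(* Main.v *)
Require Import Defs.
From HB Require Import structures.
From mathcomp Require Import all_boot all_order all_algebra.
From mathcomp Require Import boolp classical_sets cardinality reals.
From mathcomp Require Import ring.
Import Order.TTheory GRing.Theory Num.Theory.
Local Open Scope classical_set_scope.
Local Open Scope ring_scope.

(** Both problems are governed by one function, the cost of a pair made of an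
    assignment [c] of the data to the centres and a tuple [x] of centres.  A
    feasible 0-1 matrix is the same thing as an assignment, so the solutions of
    (MIP) are the pairs of least cost ([MIP_solutionsP]); and if [x] solves
    (NS), then [x] together with any assignment sending each data point to a
    nearest centre is a pair of least cost ([NS_solution_optimal],
    [optimal_NS_solution]).

    For a fixed assignment, the Huygens-Steiner identity
    ([sum_sqdist_centroid]) shows that the cost is least at the centroids of
    the clusters, and that every nonempty cluster of a minimiser must have its
    centroid as centre.  As there are finitely many assignments, a pair of
    least cost exists ([exists_optimal]).

    When the data are distinct and [k <= m], no cluster of a pair of least cost
    is empty ([optimal_surjective]): an idle centre could be moved onto a data
    point that lies off its own centre.  Hence the centres of an optimal pair
    are determined by its assignment, and the solution sets are finite.

    In the formula for the centres of a solution of (NS), the set [I(j)] counts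
    also the points that are equally close to another centre.  Since every
    choice of nearest centres is optimal, the ties can all be resolved in favour
    of the given [j]; the cluster of [j] is then exactly [I(j)], so [I(j)] is
    nonempty and its centroid is the [j]-th centre. *)

(** * Euclidean norms, minima and centroids *)

Lemma enorm_ge0 {R : realType} {n : nat} (v : 'cV[R]_n) : 0 <= enorm v.
Proof. exact: sqrtr_ge0. Qed.

Lemma enorm_sqr {R : realType} {n : nat} (v : 'cV[R]_n) :
  enorm v ^+ 2 = \sum_(r < n) v r 0 ^+ 2.
Proof. by rewrite sqr_sqrtr // sumr_ge0 // => r _; exact: sqr_ge0. Qed.

Lemma enorm_sub_sqr {R : realType} {n : nat} (u v : 'cV[R]_n) :
  enorm (u - v) ^+ 2 = \sum_(r < n) (u r 0 - v r 0) ^+ 2.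
Proof. by rewrite enorm_sqr; apply: eq_bigr => r _; rewrite !mxE. Qed.

Lemma ler_enorm_sqr {R : realType} {n : nat} (u v : 'cV[R]_n) :
  (enorm u ^+ 2 <= enorm v ^+ 2) = (enorm u <= enorm v).
Proof. by rewrite ler_sqr // nnegrE enorm_ge0. Qed.

Lemma enorm_sqr_eq0 {R : realType} {n : nat} (v : 'cV[R]_n) :
  (enorm v ^+ 2 == 0) = (v == 0).
Proof.
apply/eqP/eqP => [|->]; rewrite enorm_sqr; last first.
  by rewrite big1 // => r _; rewrite mxE expr0n.
move/eqP; rewrite psumr_eq0 => [/allP v0|r _]; last exact: sqr_ge0.
apply/colP => r; rewrite mxE; apply/eqP.
by rewrite -sqrf_eq0; apply: v0; rewrite mem_index_enum.
Qed.

Lemma minJ_le {R : realType} {k : nat} (hk : (0 < k)%N) (F : 'I_k -> R) j :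
  minJ hk F <= F j.
Proof. exact: bigmin_le. Qed.

Lemma minJP {R : realType} {k : nat} (hk : (0 < k)%N) (F : 'I_k -> R) j :
  F j = minJ hk F <-> forall q, F j <= F q.
Proof.
split=> [-> q|le_Fj]; first exact: minJ_le.
by apply/le_anti; rewrite minJ_le andbT; apply: le_bigmin => //; exact: le_Fj.
Qed.

Definition centroid {R : realType} {n m : nat} (a : 'I_m -> 'cV[R]_n)
    (S : {set 'I_m}) : 'cV[R]_n :=
  #|S|%:R^-1 *: \sum_(i in S) a i.

Lemma card_centroid {R : realType} {n m : nat} (a : 'I_m -> 'cV[R]_n)
    (S : {set 'I_m}) r :
  #|S|%:R * centroid a S r 0 = \sum_(i in S) a i r 0.
Proof.
rewrite mxE summxE mulrA; have [->|S0] := eqVneq S finset.set0.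
  by rewrite !big_set0 mulr0.
by rewrite divff ?mul1r // pnatr_eq0 cards_eq0.
Qed.

Lemma sum_sqr_sub_mean {R : realType} {I : finType} (S : {set I}) (b : I -> R)
    (g v : R) : #|S|%:R * g = \sum_(i in S) b i ->
  \sum_(i in S) (b i - v) ^+ 2 =
    \sum_(i in S) (b i - g) ^+ 2 + #|S|%:R * (g - v) ^+ 2.
Proof.
move=> gE; transitivity (\sum_(i in S)
    ((b i - g) ^+ 2 + 2 * (g - v) * (b i - g) + (g - v) ^+ 2)).
  by apply: eq_bigr => i _; ring.
have cross0 : \sum_(i in S) (b i - g) = 0.
  by rewrite sumrB sumr_const -gE mulr_natl subrr.
by rewrite !big_split /= -mulr_sumr cross0 mulr0 addr0 sumr_const mulr_natl.
Qed.

(** The Huygens-Steiner identity: expanding the squares about the centroid, the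
    cross terms cancel.  An empty [S] makes both sides zero. *)
Lemma sum_sqdist_centroid {R : realType} {n m : nat} (a : 'I_m -> 'cV[R]_n)
    (S : {set 'I_m}) (v : 'cV[R]_n) :
  \sum_(i in S) enorm (a i - v) ^+ 2 =
    \sum_(i in S) enorm (a i - centroid a S) ^+ 2
    + #|S|%:R * enorm (centroid a S - v) ^+ 2.
Proof.
under eq_bigr do rewrite enorm_sub_sqr.
under [in RHS]eq_bigr do rewrite enorm_sub_sqr.
rewrite enorm_sub_sqr exchange_big [in RHS]exchange_big mulr_sumr -big_split /=.
apply: eq_bigr => r _.
exact: sum_sqr_sub_mean (fun i => a i r 0) _ _ (card_centroid a S r).
Qed.

(** * Assignments of the data to centres *)

(** The value of MIP, up to the factor [1/m], at the 0-1 matrix that encodes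
    the assignment [c]. *)
Definition cost {R : realType} {n m k : nat} (a : 'I_m -> 'cV[R]_n)
    (c : {ffun 'I_m -> 'I_k}) (x : 'M[R]_(n, k)) : R :=
  \sum_(i < m) enorm (a i - col (c i) x) ^+ 2.

Definition cluster {m k : nat} (c : {ffun 'I_m -> 'I_k}) (j : 'I_k) :
  {set 'I_m} := [set i | c i == j]%SET.

Definition centroids {R : realType} {n m k : nat} (a : 'I_m -> 'cV[R]_n)
    (c : {ffun 'I_m -> 'I_k}) : 'M[R]_(n, k) :=
  \matrix_(r, j) centroid a (cluster c j) r 0.

Lemma col_centroids {R : realType} {n m k : nat} (a : 'I_m -> 'cV[R]_n)
    (c : {ffun 'I_m -> 'I_k}) j :
  col j (centroids a c) = centroid a (cluster c j).
Proof. by apply/colP => r; rewrite !mxE. Qed.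

Lemma cost_by_cluster {R : realType} {n m k : nat} (a : 'I_m -> 'cV[R]_n)
    (c : {ffun 'I_m -> 'I_k}) x :
  cost a c x =
    \sum_(j < k) \sum_(i in cluster c j) enorm (a i - col j x) ^+ 2.
Proof.
rewrite /cost (partition_big c predT) //=; apply: eq_bigr => j _.
by apply: eq_big => [i|i /eqP->]; rewrite ?inE.
Qed.

Lemma cost_centroids {R : realType} {n m k : nat} (a : 'I_m -> 'cV[R]_n)
    (c : {ffun 'I_m -> 'I_k}) x :
  cost a c x = cost a c (centroids a c)
    + \sum_(j < k)
        #|cluster c j|%:R * enorm (centroid a (cluster c j) - col j x) ^+ 2.
Proof.
rewrite !cost_by_cluster -big_split /=; apply: eq_bigr => j _.
by rewrite col_centroids -sum_sqdist_centroid.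
Qed.

(** The common core of the two problems: (MIP) minimises [cost] jointly, and
    (NS) is what remains after minimising over the assignment. *)
Definition optimal {R : realType} {n m k : nat} (a : 'I_m -> 'cV[R]_n)
    (c : {ffun 'I_m -> 'I_k}) (x : 'M[R]_(n, k)) : Prop :=
  forall (c' : {ffun 'I_m -> 'I_k}) (x' : 'M[R]_(n, k)),
    cost a c x <= cost a c' x'.

(** For a given assignment the centroids are the best centres, and there are
    finitely many assignments, so a finite minimum is enough. *)
Lemma exists_optimal {R : realType} {n m k : nat} (hk : (0 < k)%N)
    (a : 'I_m -> 'cV[R]_n) :
  exists (c : {ffun 'I_m -> 'I_k}) (x : 'M[R]_(n, k)), optimal a c x.
Proof.
pose c0 : {ffun 'I_m -> 'I_k} := [ffun=> Ordinal hk].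
case: (@arg_minP _ _ _ c0 xpredT (fun c => cost a c (centroids a c))) => //.
move=> c _ min_c; exists c, (centroids a c) => c' x'.
apply: le_trans (min_c c' isT) _; rewrite [leRHS]cost_centroids lerDl.
by apply: sumr_ge0 => j _; rewrite mulr_ge0 // sqr_ge0.
Qed.

(** If the cluster of [j0] were empty, two distinct data points would share a
    centre by counting, so one of them would be off its centre; making that
    point the centre [j0] strictly lowers the cost and disturbs nobody. *)
Lemma optimal_surjective {R : realType} {n m k : nat} {a : 'I_m -> 'cV[R]_n}
    {c : {ffun 'I_m -> 'I_k}} {x : 'M[R]_(n, k)} :
  (k <= m)%N -> injective a -> optimal a c x -> forall j, exists i, c i = j.
Proof.
move=> hkm inj_a opt_c j0; apply: contrapT => no_j0.
have c_neq i : c i != j0 by apply/eqP => ci; apply: no_j0; exists i.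
have [i ai_off] : exists i, a i - col (c i) x != 0.
  apply: contrapT => /forallNP on_centre.
  have aE i : a i = col (c i) x.
    by apply/eqP; rewrite -subr_eq0; apply/negPn/negP; exact: on_centre.
  have inj_c : injective c by move=> i i' cii'; apply: inj_a; rewrite !aE cii'.
  have /codomP[i ji] : j0 \in codom c by apply: inj_card_onto; rewrite ?card_ord.
  by apply: no_j0; exists i.
pose c' := [ffun i' => if i' == i then j0 else c i'].
pose x' : 'M[R]_(n, k) := \matrix_(r, j) if j == j0 then a i r 0 else x r j.
suff: cost a c' x' < cost a c x by rewrite ltNge opt_c.
rewrite /cost (bigD1 i) //= [ltRHS](bigD1 i) //= ffunE eqxx.
have -> : col j0 x' = a i by apply/colP => r; rewrite !mxE eqxx.
rewrite subrr; apply: ltr_leD.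
  have /eqP-> : enorm (0 : 'cV[R]_n) ^+ 2 == 0 by rewrite enorm_sqr_eq0.
  by rewrite lt0r enorm_sqr_eq0 ai_off sqr_ge0.
apply: ler_sum => i' /negPf i'i; rewrite ffunE i'i.
have -> // : col (c i') x' = col (c i') x.
by apply/colP => r; rewrite !mxE (negPf (c_neq i')).
Qed.

Lemma optimal_centroid {R : realType} {n m k : nat} {a : 'I_m -> 'cV[R]_n}
    {c : {ffun 'I_m -> 'I_k}} {x : 'M[R]_(n, k)} {j} :
  optimal a c x -> (exists i, c i = j) ->
  col j x = centroid a (cluster c j).
Proof.
move=> opt_c [i ci].
pose T j := #|cluster c j|%:R * enorm (centroid a (cluster c j) - col j x) ^+ 2.
have T_ge0 j' : true -> 0 <= T j' by rewrite mulr_ge0 // sqr_ge0.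
have : \sum_j T j == 0.
  rewrite eq_le sumr_ge0 // andbT.
  by have := opt_c c (centroids a c); rewrite cost_centroids gerDl.
rewrite psumr_eq0 // => /allP/(_ j); rewrite mem_index_enum => /(_ isT).
rewrite mulf_eq0 pnatr_eq0 cards_eq0 enorm_sqr_eq0 subr_eq0.
case/orP => [/eqP/setP/(_ i)|/eqP->] //.
by rewrite !inE ci eqxx.
Qed.

Lemma optimal_eq_centroids {R : realType} {n m k : nat} {a : 'I_m -> 'cV[R]_n}
    {c : {ffun 'I_m -> 'I_k}} {x : 'M[R]_(n, k)} :
  (k <= m)%N -> injective a -> optimal a c x -> x = centroids a c.
Proof.
move=> hkm inj_a opt_c; apply/matrixP => r j.
have cj := optimal_surjective hkm inj_a opt_c j.
by have /colP/(_ r) := optimal_centroid opt_c cj; rewrite !mxE.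
Qed.

(** * Solutions of (MIP) *)

Definition assign_mx {R : realType} {m k : nat} (c : {ffun 'I_m -> 'I_k}) :
  'M[R]_(m, k) := \matrix_(i, j) (c i == j)%:R.

Lemma MIP_feasibleP {R : realType} {n m k : nat}
    (p : 'M[R]_(n, k) * 'M[R]_(m, k)) :
  MIP_feasible p <-> exists c, p.2 = assign_mx c.
Proof.
split=> [[p01 p_sum]|[c pE]]; last first.
  split=> i; first by move=> j; rewrite pE mxE; case: eqP; [right|left].
  under eq_bigr do rewrite pE mxE eq_sym.
  by rewrite (bigD1 (c i)) //= eqxx big1 ?addr0 // => j /negPf ->.
have one_col i : exists j, p.2 i j == 1.
  apply: contrapT => /forallNP no_j.
  have /eqP := p_sum i; rewrite big1 ?(eq_sym 0) ?oner_eq0 // => j _.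
  by case: (p01 i j) => // /eqP /no_j.
exists [ffun i => xchoose (one_col i)]; apply/matrixP => i j; rewrite mxE ffunE.
have /eqP pi1 := xchooseP (one_col i); set j1 := xchoose _ in pi1 *.
have [<-//|j1j] := eqVneq j1 j.
case: (p01 i j) => // pij1.
(* a second entry equal to 1 would bring the row sum to at least 2 *)
have := p_sum i; rewrite (bigD1 j1) //= pi1 -[RHS]addr0 => /addrI/eqP.
rewrite psumr_eq0 => [/allP/(_ j)|j' _]; last by case: (p01 i j') => ->.
by rewrite mem_index_enum eq_sym j1j pij1 oner_eq0 => /(_ isT).
Qed.

Lemma psi_assign_mx {R : realType} {n m k : nat} (a : 'I_m -> 'cV[R]_n)
    (x : 'M[R]_(n, k)) c :
  psi a (x, assign_mx c) = m%:R^-1 * cost a c x.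
Proof.
congr (_ * _); apply: eq_bigr => i _; rewrite (bigD1 (c i)) //= mxE eqxx mul1r.
by rewrite big1 ?addr0 // => j /negPf cij; rewrite mxE eq_sym cij mul0r.
Qed.

Lemma MIP_solutionsP {R : realType} {n m k : nat} (a : 'I_m -> 'cV[R]_n)
    (p : 'M[R]_(n, k) * 'M[R]_(m, k)) : (0 < m)%N ->
  MIP_solutions a p <-> exists2 c, p.2 = assign_mx c & optimal a c p.1.
Proof.
move=> hm; have m_gt0 : 0 < m%:R^-1 :> R by rewrite invr_gt0 ltr0n.
case: p => x alpha /=; split=> [[/MIP_feasibleP[c /= ->] min_p]|[c -> opt_c]].
  exists c => // c' x'; rewrite -(ler_pM2l m_gt0) -!psi_assign_mx.
  by apply: min_p; apply/MIP_feasibleP; exists c'.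
split=> [|[x' _] /MIP_feasibleP[c' /= ->]]; first by apply/MIP_feasibleP; exists c.
by rewrite !psi_assign_mx ler_pM2l.
Qed.

(** * Solutions of (NS) *)

Definition nearest {R : realType} {n m k : nat} (a : 'I_m -> 'cV[R]_n)
    (c : {ffun 'I_m -> 'I_k}) (x : 'M[R]_(n, k)) : Prop :=
  forall i q, enorm (a i - col (c i) x) <= enorm (a i - col q x).

Lemma NS_objective_le_cost {R : realType} {n m k : nat} (hk : (0 < k)%N)
    (a : 'I_m -> 'cV[R]_n) c (x : 'M[R]_(n, k)) :
  NS_objective hk a x <= m%:R^-1 * cost a c x.
Proof.
rewrite ler_wpM2l ?invr_ge0 //; apply: ler_sum => i _.
exact: (minJ_le hk (fun j => enorm (a i - col j x) ^+ 2)).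
Qed.

Lemma NS_objective_nearest {R : realType} {n m k : nat} (hk : (0 < k)%N)
    {a : 'I_m -> 'cV[R]_n} {c} {x : 'M[R]_(n, k)} :
  nearest a c x -> NS_objective hk a x = m%:R^-1 * cost a c x.
Proof.
move=> near_c; congr (_ * _); apply: eq_bigr => i _.
symmetry; apply/(minJP hk (fun j => enorm (a i - col j x) ^+ 2)) => q.
by rewrite ler_enorm_sqr.
Qed.

(** Ties can be broken in favour of any prescribed centre [j], so that the
    cluster of [j] becomes the whole of [I(j)]. *)
Lemma exists_nearest_cluster {R : realType} {n m k : nat} (hk : (0 < k)%N)
    (a : 'I_m -> 'cV[R]_n) (x : 'M[R]_(n, k)) j :
  exists2 c, nearest a c x & cluster c j = attraction_indices hk a x j.
Proof.
pose d i q := enorm (a i - col q x).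
pose closest i := [arg min_(q < j) d i q]%O.
pose c := [ffun i => if d i j == minJ hk (d i) then j else closest i].
have closestP i q : d i (closest i) <= d i q.
  by rewrite /closest; case: arg_minP => // q0 _; apply.
have near_c : nearest a c x.
  move=> i q; rewrite ffunE; case: eqP => [/minJP|_]; last exact: closestP.
  by apply.
exists c => //; apply/setP => i; rewrite !inE; apply/eqP/idP.
  move=> ci; rewrite inE; split; first by exists i.
  by apply/(minJP hk (d i)) => q; rewrite -ci; exact: near_c.
by rewrite inE => -[_ dij]; rewrite ffunE /d dij eqxx.
Qed.

Lemma exists_nearest {R : realType} {n m k : nat} (hk : (0 < k)%N)
    (a : 'I_m -> 'cV[R]_n) (x : 'M[R]_(n, k)) : exists c, nearest a c x.
Proof.
by have [c near_c _] := exists_nearest_cluster hk a x (Ordinal hk); exists c.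
Qed.

Lemma optimal_NS_solution {R : realType} {n m k : nat} (hk : (0 < k)%N)
    {a : 'I_m -> 'cV[R]_n} {c} {x : 'M[R]_(n, k)} :
  optimal a c x -> NS_solutions hk a x.
Proof.
move=> opt_c; split=> // y _; have [c' near_c'] := exists_nearest hk a y.
rewrite (NS_objective_nearest hk near_c').
apply: le_trans (NS_objective_le_cost hk a c x) _.
by rewrite ler_wpM2l ?invr_ge0.
Qed.

Lemma NS_solution_optimal {R : realType} {n m k : nat} (hm : (0 < m)%N)
    {hk : (0 < k)%N} {a : 'I_m -> 'cV[R]_n} {c} {x : 'M[R]_(n, k)} :
  NS_solutions hk a x -> nearest a c x -> optimal a c x.
Proof.
move=> [_ min_x] near_c c' x'; have m_gt0 : 0 < m%:R^-1 :> R.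
  by rewrite invr_gt0 ltr0n.
rewrite -(ler_pM2l m_gt0) -(NS_objective_nearest hk near_c).
exact: le_trans (min_x x' I) (NS_objective_le_cost hk a c' x').
Qed.

(** * Existence, finiteness and the shape of the solutions *)

Theorem theorem1 (R : realType) (n m k : nat)
  (hn : (0 < n)%N) (hm : (0 < m)%N) (hk : (0 < k)%N) (hkm : (k <= m)%N)
  (a : 'I_m -> 'cV[R]_n) :
  (@MIP_solutions R n m k a !=set0 /\ NS_solutions hk a !=set0) /\
  (injective a ->
    finite_set (@MIP_solutions R n m k a) /\
    finite_set (NS_solutions hk a) /\
    (forall xbar : 'M[R]_(n, k), NS_solutions hk a xbar ->
       forall j : 'I_k,
         attraction_set hk a xbar j !=set0 /\
         col j xbar =
           #|attraction_indices hk a xbar j|%:R^-1 *: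
             \sum_(i in attraction_indices hk a xbar j) a i)).
Proof.
split.
  have [c [x opt_c]] := exists_optimal hk a; split.
    by exists (x, assign_mx c); apply/MIP_solutionsP => //; exists c.
  by exists x; exact: optimal_NS_solution opt_c.
move=> inj_a; split; [|split].
- apply: (@sub_finite_set _ _ (range (fun c : {ffun 'I_m -> 'I_k} =>
    (centroids a c, assign_mx c : 'M[R]_(m, k))))); last first.
    by apply: finite_image; exact: finite_finset.
  move=> [x alpha] /(MIP_solutionsP _ _ hm)[c /= -> opt_c]; exists c => //.
  by rewrite -(optimal_eq_centroids hkm inj_a opt_c).
- apply: (@sub_finite_set _ _ (range (fun c : {ffun 'I_m -> 'I_k} =>
    centroids a c))); last first.
    by apply: finite_image; exact: finite_finset.
  move=> x sol_x; have [c near_c] := exists_nearest hk a x; exists c => //.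
  rewrite -(optimal_eq_centroids hkm inj_a (x := x)) //.
  exact: NS_solution_optimal sol_x near_c.
move=> x sol_x j; have [c near_c clusterE] := exists_nearest_cluster hk a x j.
have opt_c := NS_solution_optimal hm sol_x near_c.
have cj := optimal_surjective hkm inj_a opt_c j.
split; last by rewrite -clusterE; exact: optimal_centroid.
have [i ci] := cj; exists (a i).
have : i \in attraction_indices hk a x j by rewrite -clusterE inE ci eqxx.
by rewrite inE => /set_mem.
Qed.
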